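(* Every locally paracompact strongly topological gyrogroup is paracompact.
   Context: All topological spaces are assumed to be Hausdorff. A space $X$ is locally paracompact if each point $x\in X$ has an open neighborhood $U(x)$ such that $\overline{U(x)}$ is paracompact. A gyrogroup is a nonempty set $G$ with a binary operation $\oplus$ such that: (G1) there is a unique element $0\in G$ with $0\oplus a=a=a\oplus 0$ for all $a\in G$; (G2) each $x\in G$ has a unique inverse $\ominus x$ with $\ominus x\oplus x=0=x\oplus(\ominus x)$; (G3) for all $x,y\in G$ there is an automorphism $\mathrm{gyr}[x,y]$ of $(G,\oplus)$ with $x\oplus(y\oplus z)=(x\oplus y)\oplus \mathrm{gyr}[x,y](z)$ for all $z\in G$; (G4) $\mathrm{gyr}[x\oplus y,y]=\mathrm{gyr}[x,y]$ for all $x,y\in G$. A topological gyrogroup $(G,\tau,\oplus)$ is a gyrogroup with a topology $\tau$ such that $\oplus:G\times G\to G$ is jointly continuous and $x\mapsto\ominus x$ is continuous. It is a strongly topological gyrogroup if there exists a neighborhood base $\mathscr U$ of $0$ such that for every $U\in\mathscr U$, $\mathrm{gyr}[x,y](U)=U$ for all $x,y\in G$. *)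

(* Defs.v *)
From HB Require Import structures.
From mathcomp Require Import all_boot all_order all_algebra.
From mathcomp Require Import all_classical.
From mathcomp Require Import topology.

Set Implicit Arguments.
Unset Strict Implicit.
Unset Printing Implicit Defensive.

Local Open Scope classical_set_scope.

Declare Scope gyro_scope.
Delimit Scope gyro_scope with gyro.
Local Open Scope gyro_scope.

Reserved Notation "x ⊕ y" (at level 50, left associativity).
Reserved Notation "⊖ x" (at level 35, right associativity).

(* By left cancellation the gyrations are determined by the operation, so      *)
(* carrying [gyr] as data adds nothing to (G3).                                *)
HB.mixin Record isGyrogroup (G : Type) := {
  gyro_zero : G;
  gyro_opp : G -> G;
  gyro_add : G -> G -> G;
  gyr : G -> G -> G -> G;
  gyro_add0g : left_id gyro_zero gyro_add;
  gyro_addg0 : right_id gyro_zero gyro_add;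
  gyro_zero_uniq : forall e : G,
    left_id e gyro_add -> right_id e gyro_add -> e = gyro_zero;
  gyro_addNg : left_inverse gyro_zero gyro_opp gyro_add;
  gyro_addgN : right_inverse gyro_zero gyro_opp gyro_add;
  gyro_opp_uniq : forall x y : G,
    gyro_add y x = gyro_zero -> gyro_add x y = gyro_zero -> y = gyro_opp x;
  gyr_bij : forall x y : G, bijective (gyr x y);
  gyr_morph : forall x y : G, {morph gyr x y : a b / gyro_add a b};
  gyro_addA : forall x y z : G,
    gyro_add x (gyro_add y z) = gyro_add (gyro_add x y) (gyr x y z);
  gyr_loop : forall x y : G, gyr (gyro_add x y) y =1 gyr x y
}.

#[short(type="gyrogroupType")]
HB.structure Definition Gyrogroup := {G of isGyrogroup G}.

Notation "x ⊕ y" := (gyro_add x y) : gyro_scope.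
Notation "⊖ x" := (gyro_opp x) : gyro_scope.

HB.mixin Record Gyrogroup_isTopological (G : Type)
    of Gyrogroup G & Topological G := {
  gyro_add_continuous : continuous (fun p : G * G => p.1 ⊕ p.2);
  gyro_opp_continuous : continuous (fun x : G => ⊖ x)
}.

#[short(type="topGyrogroupType")]
HB.structure Definition TopologicalGyrogroup :=
  {G of Gyrogroup G & Topological G & Gyrogroup_isTopological G}.

Definition nbhs_base (T : topologicalType) (x : T) (B : set (set T)) :=
  B `<=` nbhs x /\ forall A, nbhs x A -> exists2 U, B U & U `<=` A.

Definition strongly_topological (G : topGyrogroupType) :=
  exists2 B : set (set G), nbhs_base gyro_zero B &
    forall U, B U -> forall x y : G, gyr x y @` U = U.

Definition open_cover (T : topologicalType) (C : set (set T)) :=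
  C `<=` open /\ \bigcup_(U in C) U = [set: T].

Definition refines (T : Type) (D C : set (set T)) :=
  forall V, D V -> exists2 U, C U & V `<=` U.

Definition locally_finite (T : topologicalType) (D : set (set T)) :=
  forall x : T, exists2 N, nbhs x N &
    finite_set [set V | D V /\ V `&` N !=set0].

(* The Hausdorff axiom, usually part of the definition, is left out here: it   *)
(* is inherited by subspaces and is stated once for the ambient space.         *)
Definition paracompact (T : topologicalType) :=
  forall C : set (set T), open_cover C ->
    exists D : set (set T), [/\ open_cover D, refines D C & locally_finite D].

(* [set_type A] carries the genuine subspace topology, unlike [subspace A],    *)
(* whose carrier is the whole of T.                                            *)
Definition locally_paracompact (T : topologicalType) :=
  forall x : T, exists2 U : set T, open_nbhs x U &
    paracompact (set_type (closure U)).

(* Main.v *)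
Require Import Defs.
From mathcomp Require Import all_boot all_order all_algebra all_classical topology.
From mathcomp Require Import wochoice.

(** A strongly topological gyrogroup carries a left uniformity, and a space that
    is locally paracompact uniformly with respect to some uniformity is
    paracompact.

    Fix an open neighbourhood [O] of the identity with paracompact closure.  A
    gyration-invariant neighbourhood [U] of the identity defines the entourage
    [ball U x = {y | ⊖x ⊕ y ∈ U}].  The identities
    [(⊖x ⊕ y) ⊕ gyr[⊖x,y](⊖y ⊕ z) = ⊖x ⊕ z] and
    [⊖(⊖x ⊕ y) = gyr[⊖x,y](⊖y ⊕ x)] are those of a group up to gyrations, and
    the gyrations disappear once [U] is invariant; so a sequence of invariant
    symmetric neighbourhoods [U n] inside [O] with [U n.+1 ⊕ U n.+1 ⊆ U n]
    gives a normal sequence of entourages.  Any normal sequence [E] is, morally,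
    a pseudometric, and Rudin's proof that metric spaces are paracompact shows
    that the cover by the sets [E 0 x] has a locally finite open refinement
    ([normal_sequence_refinement]).

    Each member of this refinement lies in some translate of [closure O], which
    is closed and, left translations being homeomorphisms, paracompact.  Given
    an arbitrary open cover, refining it inside each member separately and
    collecting the results keeps local finiteness
    ([paracompact_locally_finite_cover]). *)

Set Implicit Arguments.
Unset Strict Implicit.
Unset Printing Implicit Defensive.

Local Open Scope classical_set_scope.
Local Open Scope gyro_scope.

(** * Gyrogroup identities *)

Lemma gyr_inj (G : gyrogroupType) (x y : G) : injective (gyr x y).
Proof. exact: bij_inj (gyr_bij x y). Qed.

Lemma gyro_addI (G : gyrogroupType) (a : G) : injective (gyro_add a).
Proof.
move=> b c eq_bc; apply: (@gyr_inj _ (⊖ a) a).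
have := congr1 (gyro_add (⊖ a)) eq_bc.
by rewrite !gyro_addA gyro_addNg !gyro_add0g.
Qed.

Lemma gyr0 (G : gyrogroupType) (x z : G) : gyr gyro_zero x z = z.
Proof.
by apply: (@gyro_addI _ x); rewrite -{1}[x]gyro_add0g -gyro_addA gyro_add0g.
Qed.

(** The loop property turns [gyr (⊖ x) x] into [gyr 0 x], which is trivial. *)
Lemma gyro_addKN (G : gyrogroupType) (x y : G) : ⊖ x ⊕ (x ⊕ y) = y.
Proof. by rewrite gyro_addA gyro_addNg gyro_add0g -gyr_loop gyro_addNg gyr0. Qed.

Lemma gyro_oppK (G : gyrogroupType) (x : G) : ⊖ (⊖ x) = x.
Proof. by apply: (@gyro_addI _ (⊖ x)); rewrite gyro_addgN gyro_addNg. Qed.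

Lemma gyro_addNK (G : gyrogroupType) (x y : G) : x ⊕ (⊖ x ⊕ y) = y.
Proof. by rewrite -{1}[x]gyro_oppK gyro_addKN. Qed.

Lemma gyro_sub_trans (G : gyrogroupType) (x y z : G) :
  (⊖ x ⊕ y) ⊕ gyr (⊖ x) y (⊖ y ⊕ z) = ⊖ x ⊕ z.
Proof. by rewrite -gyro_addA gyro_addNK. Qed.

Lemma gyro_opp_sub (G : gyrogroupType) (x y : G) :
  ⊖ (⊖ x ⊕ y) = gyr (⊖ x) y (⊖ y ⊕ x).
Proof.
by apply: (@gyro_addI _ (⊖ x ⊕ y)); rewrite gyro_addgN gyro_sub_trans gyro_addNg.
Qed.

Lemma gyr_opp (G : gyrogroupType) (x y a : G) : gyr x y (⊖ a) = ⊖ gyr x y a.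
Proof.
have gyr_zero : gyr x y gyro_zero = gyro_zero.
  apply: (@gyro_addI _ (gyr x y gyro_zero)).
  by rewrite -gyr_morph !gyro_addg0.
apply: (@gyro_addI _ (gyr x y a)).
by rewrite -gyr_morph !gyro_addgN gyr_zero.
Qed.

Lemma gyro_addl_continuous (G : topGyrogroupType) (a : G) :
  continuous (gyro_add a).
Proof.
move=> x; apply: (@continuous_comp G (G * G)%type G (fun y => (a, y))
  (fun p => p.1 ⊕ p.2)); last exact: gyro_add_continuous.
by apply: cvg_pair; [exact: cvg_cst | exact: cvg_id].
Qed.

(** * Paracompactness of subspaces *)

Lemma paracompact_homeo (S T : topologicalType) (f : S -> T) (g : T -> S) :
  continuous f -> continuous g -> cancel f g -> cancel g f ->
  paracompact T -> paracompact S.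
Proof.
move=> cf cg fK gK pT C [Cop Ccov].
have /continuousP fop := cf; have /continuousP gop := cg.
have [D [[Dop Dcov] DC Dlf]] : exists D : set (set T),
    [/\ open_cover D, refines D (preimage g @` C) & locally_finite D].
  apply: pT; split.
    by move=> _ [U CU <-]; apply/gop/Cop.
  apply/seteqP; split=> // t _.
  have : [set: S] (g t) by [].
  by rewrite -Ccov => -[U CU Ut]; exists (g @^-1` U) => //; exists U.
exists (preimage f @` D); split; first split.
- by move=> _ [V DV <-]; apply/fop/Dop.
- apply/seteqP; split=> // s _.
  have : [set: T] (f s) by [].
  by rewrite -Dcov => -[V DV Vs]; exists (f @^-1` V) => //; exists V.
- move=> _ [V DV <-]; have [_ [U CU <-] VU] := DC _ DV.
  by exists U => // s /VU /=; rewrite fK.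
move=> s; have [N Ns fin] := Dlf (f s).
exists (f @^-1` N); first exact: cf.
apply: sub_finite_set (finite_image (preimage f) fin).
move=> _ [[V DV <-] [t [Vt Nt]]]; exists V => //; split=> //.
by exists (f t).
Qed.

(** A homeomorphism of the ambient space restricts to one between [f @^-1` A]
    and [A]. *)
Lemma paracompact_preimage (T : topologicalType) (f g : T -> T) (A : set T) :
  continuous f -> continuous g -> cancel f g -> cancel g f ->
  paracompact (set_type A) -> paracompact (set_type (f @^-1` A)).
Proof.
move=> cf cg fK gK.
have fA (x : set_type (f @^-1` A)) : f (set_val x) \in A.
  by rewrite inE; exact: (set_valP x).
have gA (x : set_type A) : g (set_val x) \in f @^-1` A.
  by rewrite inE /= gK; exact: (set_valP x).
have cval (B : set T) : continuous (set_val : set_type B -> T).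
  exact: initial_continuous.
pose F x : set_type A := SigSub (fA x).
pose H x : set_type (f @^-1` A) := SigSub (gA x).
apply: (@paracompact_homeo _ _ F H).
- apply: continuous_comp_initial => x.
  exact: (@continuous_comp _ _ _ set_val f x (cval _ x) (cf _)).
- apply: continuous_comp_initial => x.
  exact: (@continuous_comp _ _ _ set_val g x (cval _ x) (cg _)).
- by move=> x; apply: val_inj; rewrite /= fK.
- by move=> x; apply: val_inj; rewrite /= gK.
Qed.

(** Closedness of [K] gives local finiteness at the points outside [K]: the
    complement of [K] is a neighbourhood that misses the whole family. *)
Lemma refine_in_closed_paracompact (T : topologicalType) (V K : set T)
    (C : set (set T)) :
  open V -> V `<=` K -> closed K -> paracompact (set_type K) -> open_cover C ->
  exists F : set (set T), [/\ F `<=` open, \bigcup_(A in F) A = V,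
    refines F C & locally_finite F].
Proof.
move=> Vop VK Kcl pK [Cop Ccov].
have valK (x : set_type K) : K (set_val x) by exact: (set_valP x).
have [D [[Dop Dcov] DC Dlf]] : exists D : set (set (set_type K)),
    [/\ open_cover D, refines D (preimage set_val @` C) & locally_finite D].
  apply: pK; split; first by move=> _ [U CU <-]; exists U => //; apply: Cop.
  apply/seteqP; split=> // x _.
  have : [set: T] (set_val x) by [].
  by rewrite -Ccov => -[U CU Ux]; exists (set_val @^-1` U) => //; exists U.
exists ((fun B => V `&` set_val @` B) @` D); split.
- move=> _ [B DB <-]; have [O Oop OB] := Dop _ DB.
  suff -> : V `&` set_val @` B = V `&` O by apply: openI.
  apply/seteqP; split=> x [Vx].
    by move=> [y By yx]; split=> //; move: By; rewrite -OB /= yx.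
  move=> Ox; split=> //; have xK : x \in K by rewrite inE; apply: VK.
  by exists (SigSub xK) => //; rewrite -OB.
- apply/seteqP; split=> [x [_ [B _ <-] []] // | x Vx].
  have xK : x \in K by rewrite inE; apply: VK.
  have : [set: set_type K] (SigSub xK) by [].
  rewrite -Dcov => -[B DB Bx]; exists (V `&` set_val @` B); first by exists B.
  by split=> //; exists (SigSub xK).
- move=> _ [B DB <-]; have [_ [U CU <-] BU] := DC _ DB.
  by exists U => // x [_ [y /BU Uy <-]].
move=> x; have [Kx|nKx] := pselect (K x); last first.
  exists (~` K); first by apply: open_nbhs_nbhs; split=> //; apply: closed_openC.
  suff -> : [set A | ((fun B => V `&` set_val @` B) @` D) A /\ A `&` ~` K !=set0]
      = set0 by exact: finite_set0.
  by apply/seteqP; split=> // _ [[B _ <-] [y [[/VK]]]].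
have xK : x \in K by rewrite inE.
have [N Nx fin] := Dlf (SigSub xK).
move: Nx; rewrite nbhsE => -[_ [[O Oop <-] Ox] ON].
exists O; first by apply: open_nbhs_nbhs; split.
apply: sub_finite_set (finite_image (fun B => V `&` set_val @` B) fin).
move=> _ [[B DB <-] [y [[_ [z Bz <-]] Oz]]]; exists B => //; split=> //.
by exists z; split=> //; apply: ON.
Qed.

(** Refine the given cover separately inside each member of [W].  A point has a
    neighbourhood that meets only finitely many members of [W]; shrinking it
    once for each of these makes it meet finitely many of the new sets. *)
Lemma paracompact_locally_finite_cover (T : topologicalType) (W : set (set T)) :
  open_cover W -> locally_finite W ->
  (forall V, W V ->
    exists K, [/\ V `<=` K, closed K & paracompact (set_type K)]) ->
  paracompact T.
Proof.
move=> [Wop Wcov] Wlf WK C Ccov.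
have /choice [F FP] (V : set T) : exists F : set (set T), W V ->
    [/\ F `<=` open, \bigcup_(A in F) A = V, refines F C & locally_finite F].
  have [WV|nWV] := pselect (W V); last by exists set0.
  have [K [VK Kcl pK]] := WK V WV.
  have [F HF] := refine_in_closed_paracompact (Wop _ WV) VK Kcl pK Ccov.
  by exists F.
exists (\bigcup_(V in W) F V); split; first split.
- by move=> A [V WV FA]; have [Fop _ _ _] := FP V WV; apply: Fop.
- apply/seteqP; split=> // x _.
  have : [set: T] x by [].
  rewrite -Wcov => -[V WV Vx]; have [_ FV _ _] := FP V WV.
  by move: Vx; rewrite -FV => -[A FA Ax]; exists A => //; exists V.
- by move=> A [V WV FA]; have [_ _ FC _] := FP V WV; apply: FC.
move=> x; have [N0 N0x fin0] := Wlf x.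
have /choice [N NP] (V : set T) : exists N, W V ->
    nbhs x N /\ finite_set [set A | F V A /\ A `&` N !=set0].
  have [WV|nWV] := pselect (W V); last by exists setT.
  by have [_ _ _ /(_ x) [N Nx finN]] := FP V WV; exists N.
set Q := [set V | W V /\ V `&` N0 !=set0] in fin0 *.
exists (N0 `&` \bigcap_(V in Q) N V).
  apply: filterI => //; rewrite -(fset_setK fin0).
  by apply: filter_bigI => V; rewrite in_fset_set // inE => -[/NP[]].
have finQ : finite_set (\bigcup_(V in Q) [set A | F V A /\ A `&` N V !=set0]).
  by apply: bigcup_finite => // V [/NP[]].
apply: sub_finite_set finQ => A [[V WV FA] [y [Ay [N0y Ny]]]].
have [_ FV _ _] := FP V WV.
have QV : Q V by split=> //; exists y; split=> //; rewrite -FV; exists A.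
by exists V => //; split=> //; exists y; split=> //; apply: Ny.
Qed.

(** * Locally finite refinements of uniform covers *)

(** [E n x] plays the role of the ball of radius [2 ^- n] around [x] for a
    continuous pseudometric. *)
Definition normal_sequence (T : topologicalType) (E : nat -> T -> set T) :=
  [/\ forall n x, nbhs x (E n x),
      forall n x y, E n x y -> E n y x &
      forall n x y z, E n.+1 x y -> E n.+1 y z -> E n x z].

Definition uniform_interior (T : Type) (E : nat -> T -> set T) (A : set T) :=
  [set x | exists n, E n x `<=` A].

Lemma normal_sequence_mono (T : topologicalType) (E : nat -> T -> set T) m n x :
  normal_sequence E -> m <= n -> E n x `<=` E m x.
Proof.
move=> [En _ Et] /subnKC <-; elim: (n - m) => [|k IH]; first by rewrite addn0.
rewrite addnS => y Ey; apply: IH; apply: Et Ey _.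
exact: nbhs_singleton (En _ _).
Qed.

Lemma uniform_interior_sub (T : topologicalType) (E : nat -> T -> set T) A :
  normal_sequence E -> uniform_interior E A `<=` A.
Proof. by move=> [En _ _] x [n]; apply; apply: nbhs_singleton (En _ _). Qed.

(** This is where halving the radius enters: [uniform_interior] is idempotent,
    so it produces sets that are open for the pseudometric. *)
Lemma uniform_interior_idem (T : topologicalType) (E : nat -> T -> set T) A :
  normal_sequence E ->
  uniform_interior E A `<=` uniform_interior E (uniform_interior E A).
Proof.
move=> [_ _ Et] x [n EA]; exists n.+1 => y Exy; exists n.+1 => z Eyz.
by apply: EA; apply: Et Exy Eyz.
Qed.

Lemma uniform_interior_open (T : topologicalType) (E : nat -> T -> set T) A :
  normal_sequence E -> open (uniform_interior E A).
Proof.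
move=> NE; rewrite openE => x /(uniform_interior_idem NE) [n EA].
by apply: filterS EA _; have [En _ _] := NE; apply: En.
Qed.

(** Well-order the indices and send [y] to the least [a] with [C a y]: if the
    members of index [m y] and [m z] each contain both points, then each of
    these indices is at most the other. *)
Lemma least_index (T : eqType) (C : T -> set T) : (forall y, exists a, C a y) ->
  exists m : T -> T, (forall y, C (m y) y) /\
    forall y z, C (m y) z -> C (m z) y -> m y = m z.
Proof.
move=> Ccov; have [R woR] := well_ordering_principle T.
have /choice [m mP] y : exists a, C a y /\ forall b, C b y -> R a b.
  have [a Ca] := Ccov y.
  have [w [[wC wmin] _]] : exists! w, minimum_of R (fun b => `[< C b y >]) w.
    by apply: woR; exists a; apply/asboolP.
  exists w; split; first exact/asboolP.
  by move=> b Cb; apply: wmin; apply/asboolP.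
exists m; split=> [y | y z Cyz Czy]; first by have [] := mP y.
have [[Cy yR] [Cz zR]] := (mP y, mP z).
(* Both indices are minimal in [{m y, m z}], and minima are unique. *)
have [w [_ wuniq]] : exists! w, minimum_of R (pred2 (m y) (m z)) w.
  by apply: woR; exists (m y); rewrite !inE eqxx.
have {}wuniq v : v \in pred2 (m y) (m z) -> R v (m y) -> R v (m z) -> w = v.
  move=> vyz Ry Rz; apply: wuniq; split=> // u.
  by rewrite !inE => /orP[] /eqP ->.
by rewrite -(wuniq (m y)) ?(wuniq (m z)) ?inE ?eqxx ?orbT //; auto.
Qed.

(** The sets of M. E. Rudin's proof of Stone's theorem.  The points of [T]
    index the uniform cover [E 0]; [m] assigns to a point its index.  The
    [n]-th stage for the index [a] consists of the balls of radius [2 ^- n.+2]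
    about those points of index [a] that earlier stages (whose union is [P])
    left uncovered and whose distance to the complement of the cover element
    is at least [2 ^- n]. *)
Definition rudin_stage (T : topologicalType) (E : nat -> T -> set T)
    (m : T -> T) (n : nat) (P : set T) (a : T) : set T :=
  \bigcup_(y in [set y | [/\ m y = a, ~ P y &
                            E n y `<=` uniform_interior E (E 0 a)]])
    uniform_interior E (E n.+2 y).

Fixpoint rudin_covered (T : topologicalType) (E : nat -> T -> set T)
    (m : T -> T) (n : nat) : set T :=
  if n is k.+1 then
    rudin_covered E m k `|`
      \bigcup_(a in [set: T]) rudin_stage E m k (rudin_covered E m k) a
  else set0.

Definition rudin_set (T : topologicalType) (E : nat -> T -> set T)
    (m : T -> T) (n : nat) (a : T) :=
  rudin_stage E m n (rudin_covered E m n) a.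

Lemma rudin_covered_after (T : topologicalType) (E : nat -> T -> set T) m n i a :
  n < i -> rudin_set E m n a `<=` rudin_covered E m i.
Proof.
elim: i => // i IH; rewrite ltnS leq_eqVlt => /orP[/eqP ->|/IH sub] x Dx.
  by right; exists a.
by left; apply: sub.
Qed.

Lemma rudin_coveredP (T : topologicalType) (E : nat -> T -> set T) m n x :
  rudin_covered E m n x -> exists i a, rudin_set E m i a x.
Proof. by elim: n => //= n IH [/IH // | [a _ Dx]]; exists n, a. Qed.

(** Two sets of the same stage are a positive distance apart: their centres
    [y] and [z] are within [2 ^- i] of each other when both sets meet a small
    ball, so each centre lies in the cover element of the other, and then the
    indices agree. *)
Lemma rudin_set_separated (T : topologicalType) (E : nat -> T -> set T)
    (m : T -> T) i x a b :
  normal_sequence E ->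
  (forall y z, uniform_interior E (E 0 (m y)) z ->
               uniform_interior E (E 0 (m z)) y -> m y = m z) ->
  rudin_set E m i a `&` E i.+3 x !=set0 ->
  rudin_set E m i b `&` E i.+3 x !=set0 -> a = b.
Proof.
move=> NE mE [p [[y [<- _ yC] yp] xp]] [q [[z [<- _ zC] zq] xq]].
have [_ Es Et] := NE.
have {}yp := uniform_interior_sub NE yp.
have {}zq := uniform_interior_sub NE zq.
have pq : E i.+2 p q by apply: Et (Es _ _ _ xp) xq.
have yz : E i y z.
  apply: Et (Et _ _ _ _ yp pq) _.
  by apply: normal_sequence_mono NE (leqnSn _) _ _; apply: Es.
by apply: mE; [apply: yC | apply/zC/Es].
Qed.

(** If [x] lies in the set of stage [n] together with the ball [E k x], then
    balls of a stage past [n] and at least [k] have centres outside [E k x], hence are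
    far from [x]. *)
Lemma rudin_set_far (T : topologicalType) (E : nat -> T -> set T)
    (m : T -> T) n k i x a b :
  normal_sequence E -> E k x `<=` rudin_set E m n a ->
  n < i -> k <= i -> ~ (rudin_set E m i b `&` E k.+1 x !=set0).
Proof.
move=> NE ED ni ki [p [[y [_ ny _] yp] xp]]; apply: ny.
apply: rudin_covered_after ni _ (ED _ _).
have [_ Es Et] := NE.
apply: Et xp (Es _ _ _ _).
apply: normal_sequence_mono NE _ _ (uniform_interior_sub NE yp).
by rewrite ltnS (leq_trans ki).
Qed.

Theorem normal_sequence_refinement (T : topologicalType)
    (E : nat -> T -> set T) :
  normal_sequence E -> exists D : set (set T),
    [/\ open_cover D, refines D (range (E 0)) & locally_finite D].
Proof.
move=> NE; have [En Es Et] := NE.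
have [|m [mC mE]] := @least_index T (fun a => uniform_interior E (E 0 a)).
  by move=> y; exists y; exists 0.
have Dcov x : exists n a, rudin_set E m n a x.
  have [n EC] := uniform_interior_idem NE (mC x).
  have [/rudin_coveredP // | nx] := pselect (rudin_covered E m n x).
  exists n, (m x), x => //; by exists n.+2.
have Dint n a : rudin_set E m n a `<=` uniform_interior E (rudin_set E m n a).
  move=> x [y yP /(uniform_interior_idem NE) [k Ek]].
  by exists k => z /Ek Ez; exists y.
exists [set V | exists n a, V = rudin_set E m n a]; split; first split.
- move=> _ [n [a ->]]; apply: bigcup_open => y _.
  exact: uniform_interior_open.
- apply/seteqP; split=> // x _; have [n [a Dx]] := Dcov x.
  by exists (rudin_set E m n a) => //; exists n, a.
- move=> _ [n [a ->]]; exists (E 0 a); first by exists a.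
  move=> x [y [_ _ yC] /(uniform_interior_sub NE) yx].
  apply/(uniform_interior_sub NE)/yC.
  by apply: normal_sequence_mono NE _ _ yx; rewrite (leq_trans (leqnSn n)).
move=> x; have [n [a /Dint [k Ek]]] := Dcov x.
(* From stage [s] on the sets miss the ball [E s.+2 x], which is contained in
   [E k.+1 x]; before that it is contained in [E i.+3 x], so at most one set of
   each stage meets it. *)
pose s := (n.+1 + k)%N.
exists (E s.+2 x); first exact: En.
have fin : finite_set (\bigcup_(i in `I_s)
    [set V | exists2 b, V = rudin_set E m i b & V `&` E s.+2 x !=set0]).
  apply: bigcup_finite; first exact: finite_II.
  move=> i /= lt_is.
  have [[V0 [b0 -> D0]]|none] := pselect (exists V, exists2 b,
      V = rudin_set E m i b & V `&` E s.+2 x !=set0); last first.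
    by apply: sub_finite_set (finite_set0 _) => V HV; apply: none; exists V.
  apply: sub_finite_set (finite_set1 (rudin_set E m i b0)) => _ [b -> Db].
  have sub : E s.+2 x `<=` E i.+3 x by apply: normal_sequence_mono.
  rewrite /= (@rudin_set_separated _ E m i x b b0) //.
    by case: Db => p [Dp /sub xp]; exists p.
  by case: D0 => p [Dp /sub xp]; exists p.
apply: sub_finite_set fin => _ [[i [b ->]] Db].
exists i; last by exists b.
rewrite /= ltnNge; apply/negP => le_si.
apply: (@rudin_set_far _ E m n k i x a b) => //.
- by apply: leq_trans le_si; rewrite leq_addr.
- by apply: leq_trans le_si; rewrite leq_addl.
case: Db => p [Dp xp]; exists p; split=> //.
by apply: normal_sequence_mono NE _ _ xp; rewrite ltnS leqW // leq_addl.
Qed.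

(** * The left uniformity of a strongly topological gyrogroup *)

Definition invariant_nbhs (G : topGyrogroupType) (U : set G) :=
  [/\ nbhs gyro_zero U, forall a, U a -> U (⊖ a) &
      forall x y a, U a -> U (gyr x y a)].

(** Gyrations commute with [⊖], so an invariant neighbourhood stays invariant
    when it is intersected with its opposite. *)
Lemma invariant_nbhs_sub (G : topGyrogroupType) (A : set G) :
  strongly_topological G -> nbhs gyro_zero A ->
  exists2 U, invariant_nbhs U & U `<=` A.
Proof.
move=> [B [Bn Bsub] Binv] /Bsub [V BV VA].
have gV x y a : V a -> V (gyr x y a).
  by move=> Va; rewrite -(Binv V BV x y); exists a.
exists [set a | V a /\ V (⊖ a)]; last by move=> a [/VA].
have N0 : ⊖ gyro_zero = gyro_zero :> G.
  by apply: (@gyro_addI _ gyro_zero); rewrite gyro_addgN gyro_addg0.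
split.
- apply: filterI; first exact: Bn.
  by apply: (@gyro_opp_continuous G gyro_zero); rewrite N0; apply: Bn.
- by move=> a [Va VNa]; split=> //; rewrite gyro_oppK.
- by move=> x y a [Va VNa]; split; [|rewrite -gyr_opp]; apply: gV.
Qed.

Lemma invariant_nbhs_half (G : topGyrogroupType) (A : set G) :
  strongly_topological G -> nbhs gyro_zero A ->
  exists2 U, invariant_nbhs U & forall a b, U a -> U b -> A (a ⊕ b).
Proof.
move=> sG A0.
have : nbhs ((gyro_zero, gyro_zero) : G * G) ((fun p => p.1 ⊕ p.2) @^-1` A).
  by apply: gyro_add_continuous; rewrite /= gyro_addg0.
move=> [[P Q] /= [P0 Q0] PQA].
have [U invU UPQ] := invariant_nbhs_sub sG (filterI P0 Q0).
exists U => // a b /UPQ [Pa _] /UPQ [_ Qb].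
exact: (PQA (a, b)).
Qed.

Lemma invariant_nbhs_sequence (G : topGyrogroupType) (A : set G) :
  strongly_topological G -> nbhs gyro_zero A ->
  exists U : nat -> set G, [/\ U 0 `<=` A, forall n, invariant_nbhs (U n) &
    forall n a b, U n.+1 a -> U n.+1 b -> U n (a ⊕ b)].
Proof.
move=> sG A0; have [U0 invU0 U0A] := invariant_nbhs_sub sG A0.
have /choice [h hP] (V : set G) : exists U, invariant_nbhs V ->
    invariant_nbhs U /\ forall a b, U a -> U b -> V (a ⊕ b).
  have [[V0 _ _]|nV] := pselect (invariant_nbhs V); last by exists V.
  by have [U] := invariant_nbhs_half sG V0; exists U.
have inv n : invariant_nbhs (iter n h U0).
  by elim: n => //= n /hP [].
by exists (fun n => iter n h U0); split=> // n; have [_] := hP _ (inv n).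
Qed.

(** The gyrations in [gyro_sub_trans] and [gyro_opp_sub] depend on the points,
    so it is invariance under all of them that makes these sets entourages of a
    uniformity. *)
Lemma gyro_normal_sequence (G : topGyrogroupType) (U : nat -> set G) :
  (forall n, invariant_nbhs (U n)) ->
  (forall n a b, U n.+1 a -> U n.+1 b -> U n (a ⊕ b)) ->
  normal_sequence (fun n x => [set y | U n (⊖ x ⊕ y)]).
Proof.
move=> invU UU; split=> [n x | n x y /= Uxy | n x y z /= Uxy Uyz].
- apply: (@gyro_addl_continuous G (⊖ x) x); rewrite gyro_addNg.
  by have [] := invU n.
- have [_ UN Ugyr] := invU n.
  by rewrite -[⊖ y ⊕ x]gyro_oppK gyro_opp_sub; apply/UN/Ugyr.
- rewrite -(gyro_sub_trans x y z); apply: UU => //.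
  by have [_ _ Ugyr] := invU n.+1; apply: Ugyr.
Qed.

Theorem theorem4p6 (G : topGyrogroupType) (hausG : hausdorff_space G)
  (strongG : strongly_topological G) (lpG : locally_paracompact G) :
  paracompact G.
Proof.
have [O O0 pO] := lpG gyro_zero.
have [U [UO invU UU]] := invariant_nbhs_sequence strongG (open_nbhs_nbhs O0).
have [W [Wcov Wref Wlf]] :=
  normal_sequence_refinement (gyro_normal_sequence invU UU).
apply: (paracompact_locally_finite_cover Wcov Wlf) => V /Wref [_ [x _ <-] VU].
exists (gyro_add (⊖ x) @^-1` closure O); split.
- by move=> y /VU /UO; apply: subset_closure.
- apply: closed_comp (@closed_closure _ O) => y _.
  exact: gyro_addl_continuous.
apply: (@paracompact_preimage _ _ (gyro_add x)) pO.
- exact: gyro_addl_continuous.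
- exact: gyro_addl_continuous.
- by move=> y; rewrite gyro_addNK.
- by move=> y; rewrite gyro_addKN.
Qed.
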